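(* Let $\mathcal{A}=(A,r_1,\dots,r_n)$ be a countable relational structure and let $\mathbb{K}$ be a commutative ring. If the polynomial ring $\mathbb{K}[\mathcal{A}]$ is equivariantly Noetherian, then $\mathcal{A}$ is $\omega$-well structured.
   Context: A relational structure $\mathcal{A}=(A,r_1,\dots,r_n)$ is a countable set $A$ with finitely many relations $r_i\subseteq A^{s_i}$; equality is always assumed definable, where a relation is definable if it is a Boolean combination of $r_1,\dots,r_n$. An embedding of $\mathcal{A}$ is a map $\iota:A\to A$ preserving and reflecting every $r_i$ (i.e. $r_i(a_1,\dots,a_{s_i})\iff r_i(\iota(a_1),\dots,\iota(a_{s_i}))$); $\mathrm{Emb}(\mathcal{A})$ denotes the set of embeddings. $\mathbb{K}[\mathcal{A}]$ is the ring of polynomials with coefficients in $\mathbb{K}$ whose variables are the elements of $A$. An embedding $\iota$ acts on a polynomial $f$ by renaming each variable $a$ to $\iota(a)$, giving $\iota(f)$. An ideal $\mathcal{I}\subseteq\mathbb{K}[\mathcal{A}]$ is equivariant if $\iota(f)\in\mathcal{I}$ whenever $f\in\mathcal{I}$ and $\iota\in\mathrm{Emb}(\mathcal{A})$. A basis of an equivariant ideal $\mathcal{I}$ is a subset $\mathcal{B}\subseteq\mathcal{I}$ such that every $f\in\mathcal{I}$ can be written as $\sum_{i=1}^n h_i\cdot\iota_i(g_i)$ with $g_i\in\mathcal{B}$, $h_i\in\mathbb{K}[\mathcal{A}]$, $\iota_i\in\mathrm{Emb}(\mathcal{A})$. $\mathbb{K}[\mathcal{A}]$ is equivariantly Noetherian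 if every equivariant ideal has a finite basis. A quasi order $(Y,\preceq)$ is a well quasi order (wqo) if every infinite sequence $y_1,y_2,\dots$ has $i<j$ with $y_i\preceq y_j$. For a finite $B\subseteq A$, a labelling is a function $\ell:B\to\mathbb{N}$; for labellings $\ell:B\to\mathbb{N}$ and $\ell':B'\to\mathbb{N}$ write $\ell\rightsquigarrow\ell'$ if there is $\iota\in\mathrm{Emb}(\mathcal{A})$ with $\iota(B)\subseteq B'$ and $\ell(b)\le\ell'(\iota(b))$ for all $b\in B$. $\mathcal{A}$ is $\omega$-well structured if $\rightsquigarrow$ is a wqo on the set of all such labellings of finite subsets of $A$.
   Formalization: The commutative ring K is assumed to be nonzero (1 ≠ 0); for the zero ring the polynomial ring is trivially equivariantly Noetherian and the claim fails, e.g. for the integers with successor and equality. *)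

(* Defs.v *)
From mathcomp Require Import all_boot all_order all_algebra finmap.
From mathcomp Require Import monalg.

Set Implicit Arguments.
Unset Strict Implicit.
Unset Printing Implicit Defensive.

Import GRing.Theory.

(* Finite carriers are allowed, and so are nullary relations. *)
Record rel_structure := RelStructure {
  carrier :> countType;
  nrel : nat;
  arity : 'I_nrel -> nat;
  holds : forall i : 'I_nrel, (arity i).-tuple carrier -> Prop
}.

Section Definability.

Variable S : rel_structure.

(* Boolean combinations, in k variables, of the relations of S; an atom may
   permute, repeat or omit variables. *)
Inductive bool_comb (k : nat) : Type :=
  | BTrue
  | BAtom (i : 'I_(nrel S)) of (arity i).-tuple 'I_k
  | BNot of bool_comb k
  | BAnd of bool_comb k & bool_comb k
  | BOr of bool_comb k & bool_comb k.

Fixpoint sat (k : nat) (e : k.-tuple S) (phi : bool_comb k) : Prop :=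
  match phi with
  | BTrue => True
  | BAtom i v => holds (map_tuple (tnth e) v)
  | BNot p => ~ sat e p
  | BAnd p q => sat e p /\ sat e q
  | BOr p q => sat e p \/ sat e q
  end.

Definition definable (k : nat) (R : k.-tuple S -> Prop) : Prop :=
  exists phi : bool_comb k, forall e : k.-tuple S, R e <-> sat e phi.

Definition equality_definable : Prop :=
  @definable 2 (fun e => tnth e ord0 = tnth e ord_max).

End Definability.

Definition embedding (S : rel_structure) (iota : S -> S) : Prop :=
  forall (i : 'I_(nrel S)) (t : (arity i).-tuple S),
    holds t <-> holds (map_tuple iota t).

Section EquivariantIdeals.

Local Open Scope ring_scope.

Variables (S : rel_structure) (K : comNzRingType).

(* The monoid algebra of the free commutative monoid on the carrier. *)
Local Notation polyring := {malg K[{cmonom S}]}.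

Definition var (a : S) : polyring := << ucm a >>.

(* Substitution of the variable iota a for each variable a. *)
Definition rename (iota : S -> S) (f : polyring) : polyring :=
  mmap malgC
       (fun m : {cmonom S} => \prod_(a <- finsupp m) var (iota a) ^+ m a) f.

Definition ideal (I : polyring -> Prop) : Prop :=
  [/\ I 0,
      forall f g, I f -> I g -> I (f + g)
    & forall h f, I f -> I (h * f)].

Definition equivariant (I : polyring -> Prop) : Prop :=
  forall (f : polyring) (iota : S -> S), I f -> embedding iota -> I (rename iota f).

Definition is_basis (B I : polyring -> Prop) : Prop :=
  (forall g, B g -> I g) /\
  (forall f, I f ->
     exists (n : nat) (h g : 'I_n -> polyring) (iota : 'I_n -> S -> S),
       [/\ forall i, B (g i),
           forall i, embedding (iota i)
         & f = \sum_(i < n) h i * rename (iota i) (g i)]).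

Definition equivariantly_Noetherian : Prop :=
  forall I : polyring -> Prop, ideal I -> equivariant I ->
    exists s : seq polyring, is_basis (fun g => g \in s) I.

End EquivariantIdeals.

Definition wqo (Y : Type) (le : Y -> Y -> Prop) : Prop :=
  [/\ forall y, le y y,
      forall x y z, le x y -> le y z -> le x z
    & forall y : nat -> Y, exists i j : nat, (i < j)%N /\ le (y i) (y j)].

(* A labelling of a finite subset B of the carrier is a finite map with
   domain B; the label 0 is distinct from being outside the domain. *)
Definition labelling (S : rel_structure) : Type := {fmap S -> nat}.

Definition label_le (S : rel_structure) (l l' : labelling S) : Prop :=
  exists iota : S -> S,
    embedding iota /\
    forall (b : S) (hb : b \in domf l),
      exists hb' : iota b \in domf l', (l.[hb]%fmap <= l'.[hb']%fmap)%N.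

Definition omega_well_structured (S : rel_structure) : Prop :=
  wqo (@label_le S).

(* Main.v *)
(** A labelling [l] becomes the monomial [\prod_(b in dom l) b ^ (l b + 1)], so
    that [l ~> l'] holds exactly when some renaming of the monomial of [l]
    divides that of [l'].  Given a sequence [y] of labellings, let [I_n] be the
    equivariant monomial ideal generated by the monomials of [y 0, .., y n.-1].
    The union of the [I_n] has a finite basis, which lies in a single [I_n];
    hence the monomial of [y n] lies in [I_n], i.e. [y i ~> y n] for some
    [i < n]. *)

Require Import Defs.
From mathcomp Require Import all_boot all_algebra.
From mathcomp Require Import finmap monalg.

Set Implicit Arguments.
Unset Strict Implicit.
Unset Printing Implicit Defensive.

Import GRing.Theory.

Lemma embedding_id (A : rel_structure) : @embedding A id.
Proof.
move=> i t; suff -> : map_tuple id t = t by [].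
by apply: val_inj; rewrite /= map_id.
Qed.

Lemma embedding_comp (A : rel_structure) (f g : A -> A) :
  embedding f -> embedding g -> embedding (g \o f).
Proof.
move=> ef eg i t.
have -> : map_tuple (g \o f) t = map_tuple g (map_tuple f t).
  by apply: val_inj; rewrite /= map_comp.
exact: iff_trans (ef i t) (eg i _).
Qed.

Section MonomialIdeals.

Local Open Scope ring_scope.

Variables (A : rel_structure) (K : comNzRingType).
Local Notation polyring := {malg K[{cmonom A}]}.

Implicit Type P : {cmonom A} -> Prop.

Definition monomial_ideal P (f : polyring) : Prop :=
  forall m, m \in msupp f -> P m.

(** Two closure properties in one: [iota := id] gives closure under multiples, hence an ideal, and a
    general [iota] gives equivariance. *)
Definition emb_upclosed P : Prop :=
  forall (iota : A -> A) (m m' : {cmonom A}), embedding iota ->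
    (forall a, m a <= m' (iota a))%N -> P m -> P m'.

Lemma monomial_idealU P m : monomial_ideal P << m >> <-> P m.
Proof.
rewrite /monomial_ideal msuppU1; split=> [|Pm k /fset1P ->//].
by apply; rewrite fset11.
Qed.

Lemma ideal_monomial_ideal P : emb_upclosed P -> ideal (monomial_ideal P).
Proof.
move=> upP; split.
- by move=> m; rewrite msupp0.
- move=> f g Pf Pg m /(fsubsetP (msuppD_le f g)) /fsetUP [] ; first exact: Pf.
  exact: Pg.
- move=> h f Pf m /msuppM_le [k1 [k2 [_ /Pf Pk2 ->]]].
  apply: (upP id k2) => // [|a]; first exact: embedding_id.
  by rewrite cmM leq_addl.
Qed.

Lemma monomial_ideal_sum P (T : Type) (s : seq T) (Q : pred T) (F : T -> polyring) :
  emb_upclosed P -> (forall i, Q i -> monomial_ideal P (F i)) ->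
  monomial_ideal P (\sum_(i <- s | Q i) F i).
Proof.
move=> /ideal_monomial_ideal [P0 PD _] PF.
exact: (big_ind (monomial_ideal P)).
Qed.

Lemma msupp_varX (b : A) n m : m \in msupp (var K b ^+ n) -> (n <= m b)%N.
Proof.
elim: n m => // n IHn m; rewrite exprS => /msuppM_le [k1 [k2 [k1U /IHn le2 ->]]].
by move: k1U; rewrite msuppU1 => /fset1P ->; rewrite cmM cmUU.
Qed.

(** The factor for [a] alone contributes [m a] to the exponent of [iota a]; the other factors can
    only increase it. *)
Lemma msupp_rename_monom (iota : A -> A) (m m' : {cmonom A}) :
  m' \in msupp (\prod_(a <- finsupp m) var K (iota a) ^+ m a) ->
  forall a, (m a <= m' (iota a))%N.
Proof.
move=> m'P a; have [a_m|] := boolP (a \in finsupp m); last first.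
  by rewrite -cmE_eq0 => /eqP ->.
move: m'P; rewrite (big_rem a) //= => /msuppM_le [k1 [k2 [/msupp_varX le1 _ ->]]].
by rewrite cmM (leq_trans le1) // leq_addr.
Qed.

Lemma equivariant_monomial_ideal P :
  emb_upclosed P -> equivariant (monomial_ideal P).
Proof.
(* [big_seq_cond] records that each summation index lies in the support of [f], so that [Pf] applies
   to it. *)
move=> upP f iota Pf eiota; rewrite /rename mmapE big_seq_cond.
apply: monomial_ideal_sum => // m; rewrite andbT => /Pf Pm.
have [_ _] := ideal_monomial_ideal upP; apply => m' /msupp_rename_monom.
by move/(upP _ _ _ eiota); apply.
Qed.

(** Meant for an [I] that is a priori larger than [monomial_ideal P]: an equivariant ideal
    containing a basis of [I] contains [I]. *)
Lemma basis_monomial_ideal P (B I : polyring -> Prop) : emb_upclosed P ->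
  is_basis B I -> (forall g, B g -> monomial_ideal P g) ->
  forall f, I f -> monomial_ideal P f.
Proof.
move=> upP [_ BI] PB f /BI [n [h [g [iota [Bg eiota ->]]]]].
apply: monomial_ideal_sum => // i _.
have [_ _] := ideal_monomial_ideal upP; apply.
exact: equivariant_monomial_ideal (PB _ (Bg i)) (eiota i).
Qed.

End MonomialIdeals.

(** By monotonicity, the maximum of finitely many witnesses serves for all of [s]. *)
Lemma bounded_witness (T : eqType) (s : seq T) (Q : nat -> T -> Prop) :
  (forall n n' x, n <= n' -> Q n x -> Q n' x) ->
  (forall x, x \in s -> exists n, Q n x) ->
  exists n, forall x, x \in s -> Q n x.
Proof.
move=> mono; elim: s => [|x s IHs] exQ; first by exists 0.
have [n Qx] := exQ x (mem_head x s).
have [|n' Qs] := IHs; first by move=> z zs; apply: exQ; rewrite inE zs orbT.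
exists (maxn n n') => z; rewrite inE => /predU1P [->|zs].
  exact: mono (leq_maxl n n') Qx.
exact: mono (leq_maxr n n') (Qs z zs).
Qed.

Section Labellings.

Variable A : rel_structure.
Implicit Types l : labelling A.

(* The exponents are shifted by one so that the label 0 is not lost. *)
Definition label_monom l : {cmonom A} :=
  [cmonom (if l.[? a]%fmap is Some n then n.+1 else 0) | a in domf l]%M.

Lemma label_monomE l a :
  label_monom l a = if l.[? a]%fmap is Some n then n.+1 else 0.
Proof. by rewrite cmE fsfunE; case: ifP => // /negbT/not_fnd ->. Qed.

Definition label_dvd l (m : {cmonom A}) : Prop :=
  exists iota : A -> A, embedding iota /\
    forall a, label_monom l a <= m (iota a).

Lemma emb_upclosed_label_dvd l : emb_upclosed (label_dvd l).
Proof.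
move=> iota m m' eiota le_mm' [kappa [ekappa le_lm]].
exists (iota \o kappa); split=> [|a]; first exact: embedding_comp.
exact: leq_trans (le_lm a) (le_mm' _).
Qed.

Lemma label_dvd_monom l l' : label_dvd l (label_monom l') <-> label_le l l'.
Proof.
split=> -[iota [eiota le_ll']]; exists iota; split=> // b.
- move=> hb; have := le_ll' b; rewrite !label_monomE (in_fnd hb).
  have hb' : l'.[? iota b]%fmap -> iota b \in domf l' by case: fndP.
  (* Outside [domf l'] the exponent would be 0, below the successor on the left. *)
  case Dl': l'.[? _]%fmap hb' => [n|//] /(_ isT) hb' le_b; exists hb'.
  by move: Dl'; rewrite (in_fnd hb') => -[->].
- rewrite !label_monomE; case: fndP => // hb.
  by have [hb' le_b] := le_ll' b hb; rewrite (in_fnd hb').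
Qed.

Lemma label_le_refl l : label_le l l.
Proof. by apply/label_dvd_monom; exists id; split=> //; apply: embedding_id. Qed.

(** This is the upward closure of [label_dvd l1]. *)
Lemma label_le_trans l1 l2 l3 : label_le l1 l2 -> label_le l2 l3 -> label_le l1 l3.
Proof.
move=> /label_dvd_monom le12 /label_dvd_monom [iota [eiota le23]].
exact/label_dvd_monom/(emb_upclosed_label_dvd eiota le23).
Qed.

End Labellings.

Theorem theorem3p1 (A : rel_structure) (K : comNzRingType) :
  equality_definable A ->
  equivariantly_Noetherian A K ->
  omega_well_structured A.
Proof.
move=> _ noethA; split; [exact: label_le_refl | exact: label_le_trans |].
move=> y.
pose P n m := exists i, i < n /\ label_dvd (y i) m.
have upP n : emb_upclosed (P n).
  move=> iota m m' eiota le_mm' [i [lt_in /(emb_upclosed_label_dvd eiota le_mm')]].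
  by exists i.
have monoP n n' m : n <= n' -> P n m -> P n' m.
  by move=> le_nn' [i [lt_in dvd_im]]; exists i; rewrite (leq_trans lt_in).
(* Supports being finite and [P] increasing, [monomial_ideal Q] is the union of the chain
   [monomial_ideal (P n)]. *)
pose Q m := exists n, P n m.
have upQ : emb_upclosed Q.
  by move=> iota m m' eiota le_mm' [n /(upP n _ _ _ eiota le_mm')]; exists n.
have [s basis_s] := noethA (monomial_ideal Q) (ideal_monomial_ideal K upQ)
                           (equivariant_monomial_ideal (K := K) upQ).
have [n Ps] : exists n, forall g, g \in s -> monomial_ideal (P n) g.
  apply: bounded_witness => [n n' g le_nn' Pg m /Pg|g gs]; first exact: monoP.
  (* The outer bound ranges over the basis, this one over the monomials of a single generator. *)
  by apply: bounded_witness => [n n' m|m /(proj1 basis_s g gs)//]; apply: monoP.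
have : monomial_ideal (P n) (<< label_monom (y n) >> : {malg K[{cmonom A}]})%R.
  apply: basis_monomial_ideal basis_s Ps _ _; first exact: upP.
  (* [P n] only sees indices below [n], so [y n] enters the union through stage [n.+1]; the basis
     then brings it back to stage [n]. *)
  apply/monomial_idealU; exists n.+1, n; split=> //.
  exact/label_dvd_monom/label_le_refl.
by move=> /monomial_idealU [i [lt_in /label_dvd_monom le_in]]; exists i, n.
Qed.
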